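(* Let $n\ge 2$ and let $f_n$ be a complex-valued weight function on triangles such that $f_{n,l,j,r}$ ($1\le l<j<r\le n$) depends only on $r-j$, $r-l$, $j-l$ and possibly $n$. Then: 1. For all $1\le l\le n-1$, $$\mathbb{E}(\mathcal{S}_{n,l,n})=\frac{1}{C_{n-l-1}}\sum_{j=l}^{n-2}\beta_{n,j}\binom{2j-2l}{j-l},\qquad\text{where}\qquad \beta_{n,j}=\sum_{s=j+1}^{n-1} f_{n,j,s,n}\,C_{s-j-1}C_{n-s-1}.$$ In particular, $l=1$ gives $\mathbb{E}(\mathcal{S}_n)$. 2. With $\beta_{n,j}$ as in part 1, $$\mathrm{Var}(\mathcal{S}_n)=\frac{1}{C_{n-2}}\sum_{j=1}^{n-2}\lambda_{n,j}\binom{2j-2}{j-1}-\frac{1}{C_{n-2}^2}\left(\sum_{j=1}^{n-2}\beta_{n,j}\binom{2j-2}{j-1}\right)^2,$$ where $$\lambda_{n,s}=\sum_{j=s+1}^{n-1}C_{j-s-1}C_{n-j-1}\Bigl(f_{n,s,j,n}^2+2f_{n,s,j,n}\bigl(\mathbb{E}(\mathcal{S}_{n,s+n-j,n})+\mathbb{E}(\mathcal{S}_{n,j,n})\bigr)+2\,\mathbb{E}(\mathcal{S}_{n,s+n-j,n})\,\mathbb{E}(\mathcal{S}_{n,j,n})\Bigr).$$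
   Context: $P_n$ is a convex polygon with vertices $v_{n,1},\dots,v_{n,n}$ in clockwise order. A triangulation of a convex $m$-gon is a set of $m-3$ noncrossing diagonals partitioning it into $m-2$ triangles; there are $C_{m-2}$ of them, where $C_k=\frac{1}{k+1}\binom{2k}{k}$ is the $k$-th Catalan number. For $1\le l<r\le n$, $P_{n,l,r}$ is the convex hull of $v_{n,l},v_{n,l+1},\dots,v_{n,r}$ (a convex polygon with $r-l+1$ vertices), and $\mathcal{T}_{n,l,r}$ is a uniformly random triangulation of $P_{n,l,r}$ (probability $1/C_{r-l-1}$ each). If $r=l+1$, there is one (empty) triangulation, with no triangles. A weight function $f_n$ assigns a complex number to each triangle with vertices among $v_{n,1},\dots,v_{n,n}$; for $l<j<r$, $f_{n,l,j,r}$ denotes the weight of the triangle with vertices $v_{n,l},v_{n,j},v_{n,r}$. $\mathcal{S}_{n,l,r}=\sum_{\Delta\in\mathcal{T}_{n,l,r}}f_n(\Delta)$ is the sum of the weights of all triangles of $\mathcal{T}_{n,l,r}$ (so $\mathcal{S}_{n,l,l+1}=0$), and $\mathcal{S}_n=\mathcal{S}_{n,1,n}$. $\mathbb{E}$ denotes expectation and $\mathrm{Var}(X)=\mathbb{E}(X^2)-(\mathbb{E}X)^2$. Empty sums are $0$. *)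

(* Defs.v *)
From mathcomp Require Import all_boot all_order all_algebra.
From mathcomp Require Import complex reals.

Set Implicit Arguments.
Unset Strict Implicit.
Unset Printing Implicit Defensive.

Import Order.TTheory GRing.Theory Num.Theory.
Local Open Scope ring_scope.

Definition catalan {F : fieldType} (k : nat) : F :=
  'C(2 * k, k)%:R / k.+1%:R.

Section Triangulations.

(* The vertex v_{n,i} of the convex polygon P_n, 1 <= i <= n, is represented
   by the ordinal i; the ordinal 0 is not a vertex and never occurs below,
   where always 1 <= l.  A segment is the pair of its endpoints, the smaller
   index first; a triangle lists its vertices in increasing order. *)
Variable n : nat.
Implicit Types (l r : nat) (T : {set 'I_n.+1 * 'I_n.+1}).

(* The polygon P_{n,l,r} has vertices l, ..., r and sides {i, i+1}, l <= i < r,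
   and {l, r}.  For r = l + 1 it degenerates to a segment. *)
Definition is_side l r (d : 'I_n.+1 * 'I_n.+1) : bool :=
  [&& (l <= d.1)%N, (d.1 < d.2)%N, (d.2 <= r)%N &
      (d.2 == d.1.+1 :> nat) || ((d.1 == l :> nat) && (d.2 == r :> nat))].

Definition is_diagonal l r (d : 'I_n.+1 * 'I_n.+1) : bool :=
  [&& (l <= d.1)%N, (d.1 < d.2)%N, (d.2 <= r)%N & ~~ is_side l r d].

(* Two chords of a convex polygon meet in their interiors without overlapping
   exactly when their endpoints strictly interleave along the boundary. *)
Definition crossing (d e : 'I_n.+1 * 'I_n.+1) : bool :=
  [&& (d.1 < e.1)%N, (e.1 < d.2)%N & (d.2 < e.2)%N] ||
  [&& (e.1 < d.1)%N, (d.1 < e.2)%N & (e.2 < d.2)%N].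

(* P_{n,l,r} is an m-gon with m = r - l + 1, so m - 3 = r - l - 2; truncated
   subtraction makes set0 the only triangulation when r = l + 1. *)
Definition is_triangulation l r T : bool :=
  [&& [forall d in T, is_diagonal l r d],
      [forall d in T, forall e in T, ~~ crossing d e] &
      #|T| == (r - l - 2)%N].

Definition triangulations l r : {set {set 'I_n.+1 * 'I_n.+1}} :=
  [set T | is_triangulation l r T].

Definition is_edge l r T (d : 'I_n.+1 * 'I_n.+1) : bool :=
  is_side l r d || (d \in T).

(* Since the vertices are in convex position, no diagonal of T enters a
   triangle all of whose edges are sides or belong to T, so these triangles
   are exactly the pieces into which T cuts the polygon. *)
Definition triangles l r T : {set 'I_n.+1 * 'I_n.+1 * 'I_n.+1} :=
  [set t | let: (a, b, c) := t in
     [&& is_edge l r T (a, b), is_edge l r T (b, c) & is_edge l r T (a, c)]].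

Definition weight_sum (V : nmodType) (f : nat -> nat -> nat -> V) l r T : V :=
  \sum_(t in triangles l r T) f t.1.1 t.1.2 t.2.

(* Expectation and variance of a function X of the uniformly random
   triangulation of P_{n,l,r}.  The variance of a complex-valued X involves
   no conjugation. *)
Definition expect {F : fieldType} l r
    (X : {set 'I_n.+1 * 'I_n.+1} -> F) : F :=
  \sum_(T in triangulations l r) X T / #|triangulations l r|%:R.

Definition variance {F : fieldType} l r
    (X : {set 'I_n.+1 * 'I_n.+1} -> F) : F :=
  expect l r (fun T => X T ^+ 2) - (expect l r X) ^+ 2.

End Triangulations.

Definition translation_invariant (V : Type) (n : nat)
    (f : nat -> nat -> nat -> V) : Prop :=
  forall l j r l' j' r' : nat,
    (1 <= l)%N -> (l < j)%N -> (j < r)%N -> (r <= n)%N ->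
    (1 <= l')%N -> (l' < j')%N -> (j' < r')%N -> (r' <= n)%N ->
    (r - j = r' - j')%N -> (r - l = r' - l')%N -> (j - l = j' - l')%N ->
    f l j r = f l' j' r'.

Section Coefficients.

Variables (F : fieldType) (n : nat) (f : nat -> nat -> nat -> F).

(* mean l is E(S_{n,l,n}). *)
Definition mean (l : nat) : F := expect l n (@weight_sum n F f l n).

Definition beta (j : nat) : F :=
  \sum_(j.+1 <= s < n) f j s n * catalan (s - j - 1) * catalan (n - s - 1).

Definition lambda (s : nat) : F :=
  \sum_(s.+1 <= j < n) catalan (j - s - 1) * catalan (n - j - 1) *
    (f s j n ^+ 2
     + 2 * f s j n * (mean (s + n - j) + mean j)
     + 2 * mean (s + n - j) * mean j).

End Coefficients.

(* Main.v *)
(** Splitting a triangulation of [P_{n,l,r}] at the apex [j] of the triangle on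
    the side [{l, r}] gives a pair of triangulations of [P_{n,l,j}] and
    [P_{n,j,r}].  Hence the unnormalized moments [X_{l,r}] of the weight sum
    (totals of its first or second power over all triangulations) satisfy
    [X_{l,r} = sum_j (g_{l,j,r} + X_{l,j} C_{r-j-1} + C_{j-l-1} X_{j,r})].
    By translation invariance [X_{l,j} = X_{l+n-j,n}], so for [r = n] the
    recurrence becomes [X_l = b_l + 2 sum_j C_{j-l-1} X_j].  In generating
    functions this is division by [1 - 2 z C(z) = sqrt (1 - 4 z)], i.e.
    convolution with the central binomial coefficients. *)

Require Import Defs.
From mathcomp Require Import all_boot all_order all_algebra.
From mathcomp Require Import complex reals.
From mathcomp Require Import zify ring.

Set Implicit Arguments.
Unset Strict Implicit.
Unset Printing Implicit Defensive.

Import Order.TTheory GRing.Theory Num.Theory.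
Local Open Scope ring_scope.

(** * Catalan numbers, central binomial coefficients and their convolutions *)

Section CatalanNumbers.
Variable F : numFieldType.
Local Notation c := (@catalan F).

Lemma catalan0 : c 0 = 1.
Proof. by rewrite /catalan bin0 divr1. Qed.

Lemma catalan_neq0 k : c k != 0.
Proof.
by rewrite /catalan mulf_neq0 ?invr_eq0 ?pnatr_eq0 // -lt0n bin_gt0 mul2n -addnn leq_addr.
Qed.

Lemma central_binE k : 'C(2 * k, k)%:R = k.+1%:R * c k.
Proof. by rewrite /catalan mulrC divfK // pnatr_eq0. Qed.

(** The ratio of consecutive central binomial coefficients, from two absorption identities; written
    without division. *)
Lemma catalanS k : k.+2%:R * c k.+1 = (4 * k + 2)%:R * c k.
Proof.
have bin_rec : (k.+1 * 'C(2 * k.+1, k.+1) = (4 * k + 2) * 'C(2 * k, k))%N.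
  have e1 := mul_bin_diag (2 * k).+2 k; have e2 := mul_bin_down (2 * k).+1 k.
  have -> : (2 * k.+1 = (2 * k).+2)%N by lia.
  rewrite /= in e1 e2; rewrite -e1.
  have e3 : ((2 * k).+1 - k = k.+1)%N by lia.
  by rewrite e3 in e2; nia.
have k0 : k.+1%:R != 0 :> F by rewrite pnatr_eq0.
apply: (mulfI k0).
by rewrite -central_binE -natrM bin_rec natrM central_binE mulrCA.
Qed.

(* Symmetrize under [i <-> k - i]. *)
Lemma sum_succ_mul_catalan k :
  2 * (\sum_(i < k.+1) i.+1%:R * c i * c (k - i)) =
  k.+2%:R * (\sum_(i < k.+1) c i * c (k - i)).
Proof.
rewrite mulr2n mulrDl !mul1r {1}(reindex_inj rev_ord_inj) /= -big_split /=.
rewrite mulr_sumr; apply: eq_bigr => i _.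
have ik := ltn_ord i.
have -> : (k.+1 - i.+1 = k - i)%N by lia.
have -> : (k - (k - i) = i)%N by lia.
have -> : k.+2%:R = (k - i).+1%:R + i.+1%:R :> F.
  by rewrite -natrD; congr (_%:R); lia.
ring.
Qed.

(** Segner's recurrence follows from the linear recurrence [catalanS]. Symmetrization turns [k + 3]
    times the convolution of order [k + 1] into a sum with weights [i + 1]. In its tail,
    [(i + 2) c (i + 1) = (4 (i + 1) - 2) c i] leads back to the weighted and plain sums of order
    [k], both known by induction. *)
Lemma catalan_conv k : \sum_(i < k.+1) c i * c (k - i) = c k.+1.
Proof.
have nz m : m.+1%:R != 0 :> F by rewrite pnatr_eq0.
elim: k => [|k IH].
  rewrite big_ord1 subnn catalan0 mul1r; apply: (mulfI (nz 1%N)).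
  by rewrite catalanS catalan0.
apply: (mulfI (nz k.+2)); rewrite -sum_succ_mul_catalan big_ord_recl /= subn0.
have -> : \sum_(i < k.+1) (bump 0 i).+1%:R * c (bump 0 i) * c (k.+1 - bump 0 i)
   = 4 * (\sum_(i < k.+1) i.+1%:R * c i * c (k - i))
     - 2 * (\sum_(i < k.+1) c i * c (k - i)).
  rewrite !mulr_sumr -sumrB; apply: eq_bigr => i _.
  rewrite /bump /= add1n subSS catalanS.
  have -> : (4 * i + 2)%:R = 4 * i.+1%:R - 2 :> F.
    by rewrite natrD natrM -(natr1 i); ring.
  ring.
have := sum_succ_mul_catalan k; rewrite IH => H.
rewrite [RHS]catalanS catalan0.
have -> : (4 * k.+1 + 2)%:R = 2 + 4 * k.+2%:R - 4 :> F.
  by rewrite natrD natrM -(natr1 k.+1); ring.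
transitivity (2 * c k.+1 + 4 * (2 * (\sum_(i < k.+1) i.+1%:R * c i * c (k - i)))
   - 4 * c k.+1); first by ring.
rewrite H; ring.
Qed.

(** With [B(z)] the generating function of the central binomials, this is
    [2 z B(z) C(z) = B(z) - 1], that is, [B] inverts [1 - 2 z C(z)]. Since [(i + 1) c i] is the
    central binomial, it is the symmetrized Catalan convolution. *)
Lemma central_bin_conv k :
  2 * (\sum_(i < k.+1) 'C(2 * i, i)%:R * c (k - i)) = 'C(2 * k.+1, k.+1)%:R.
Proof.
rewrite central_binE -catalan_conv -sum_succ_mul_catalan; congr (_ * _).
by apply: eq_bigr => i _; rewrite central_binE.
Qed.

Lemma central_bin_conv_nat l i : (l < i)%N ->
  2 * (\sum_(l.+1 <= j < i.+1) c (j - l - 1) * 'C(2 * (i - j), i - j)%:R) =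
  'C(2 * (i - l), i - l)%:R.
Proof.
move=> li; have [k ->] : exists k, i = (l + k.+1)%N by exists (i - l.+1)%N; lia.
have -> : (l + k.+1 - l = k.+1)%N by lia.
rewrite -central_bin_conv big_nat_rev -{1}[l.+1]add0n big_addn.
have -> : ((l + k.+1).+1 - l.+1 = k.+1)%N by lia.
rewrite big_mkord; congr (_ * _); apply: eq_bigr => j _; have := ltn_ord j => jk.
rewrite mulrC; congr (_%:R * c _); last by lia.
by congr binomial; lia.
Qed.

(** Downward induction on [l]: insert the solution for every [j > l] and collect the coefficient of
    each [b i]; [central_bin_conv_nat] sums it to a central binomial. *)
Lemma catalan_recurrence n l0 (x b : nat -> F) :
    (forall l, (l0 <= l < n)%N ->
      x l = b l + 2 * (\sum_(l.+1 <= j < n) c (j - l - 1) * x j)) ->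
  forall l, (l0 <= l < n)%N ->
    x l = \sum_(l <= j < n) b j * 'C(2 * (j - l), j - l)%:R.
Proof.
move=> xE l; have [k] := ubnP (n - l); elim: k l => // k IH l lk /andP[l0l ln].
rewrite xE ?l0l // [RHS]big_ltn // subnn muln0 bin0 mulr1; congr (_ + _).
(* The inner range is widened to start at [l + 1], with a guard [j <= i], so that the two sums can
   be exchanged. *)
transitivity (2 * (\sum_(l.+1 <= j < n) \sum_(l.+1 <= i < n | (j <= i)%N)
    c (j - l - 1) * (b i * 'C(2 * (i - j), i - j)%:R))).
  congr (_ * _); apply: eq_big_nat => j /andP[lj jn].
  by rewrite -mulr_sumr IH; [rewrite (big_nat_widenl _ _ _ _ _ lj)|lia|lia].
rewrite (exchange_big_dep_nat xpredT) //= mulr_sumr.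
apply: eq_big_nat => i /andP[li iN].
rewrite -central_bin_conv_nat // mulrCA; congr (_ * _).
rewrite (big_nat_widen _ i.+1 n) // mulr_sumr.
by apply: eq_big => // j _; rewrite mulrCA.
Qed.

(** * Recurrences over subpolygons with a translation-invariant source term *)

Section TranslationInvariantRecurrence.
Variables (n : nat) (g : nat -> nat -> nat -> F) (x : nat -> nat -> F).
Hypothesis g_shift : forall l j r d, (1 <= l)%N -> (l < j < r)%N -> (r + d <= n)%N ->
  g (l + d)%N (j + d)%N (r + d)%N = g l j r.
Hypothesis x_rec : forall l r, (l < r)%N -> (r <= n)%N ->
  x l r = \sum_(l.+1 <= j < r) (g l j r + x l j * c (r - j - 1) + c (j - l - 1) * x j r).

(** Induction on [r - l]: the recurrence passes the invariance of [g] on to [x]. *)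
Lemma recurrence_shift l r d : (1 <= l)%N -> (l < r)%N -> (r + d <= n)%N ->
  x (l + d)%N (r + d)%N = x l r.
Proof.
have [k] := ubnP (r - l); elim: k l r => // k IH l r rlk l1 lr rdn.
rewrite !x_rec; try lia.
rewrite -addSn big_addn addnK; apply: eq_big_nat => j ljr.
rewrite g_shift // !IH; try lia.
by congr (_ + _ * c _ + c _ * _); lia.
Qed.

Lemma recurrence_solution l : (1 <= l)%N -> (l <= n - 1)%N ->
  x l n = \sum_(l <= j < n - 1)
    (\sum_(j.+1 <= s < n) g j s n) * 'C(2 * j - 2 * l, j - l)%:R.
Proof.
move=> l1 ln.
pose b j := \sum_(j.+1 <= s < n) g j s n.
have rec k : (1 <= k < n)%N ->
    x k n = b k + 2 * (\sum_(k.+1 <= j < n) c (j - k - 1) * x j n).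
  move=> kn; rewrite x_rec //; try lia.
  rewrite !big_split /= -addrA; congr (_ + _).
  rewrite mulr2n mulrDl !mul1r; congr (_ + _).
  (* Reversal sends [j] to [k + n - j]; the left part, from [k] to [k + n - j], then shifts by
     [j - k] onto the right part from [j] to [n]. *)
  rewrite big_nat_rev /=; apply: eq_big_nat => j kjn.
  rewrite mulrC; congr (c _ * _); first by lia.
  by rewrite -(@recurrence_shift _ _ (j - k)); try lia; congr x; lia.
have ln' : (1 <= l < n)%N by lia.
rewrite (catalan_recurrence rec ln').
(* The term at [n - 1] has an empty source sum, so the range may stop at [n - 2]. *)
have b0 : b (n - 1)%N = 0 by rewrite /b big_geq //; lia.
have n_gt0 : (0 < n)%N by lia.
rewrite -{1}(subnK n_gt0) addn1 big_nat_recr //= b0 mul0r addr0.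
by apply: eq_big_nat => j _; rewrite mulnBr.
Qed.
End TranslationInvariantRecurrence.
End CatalanNumbers.

(** * Noncrossing chord sets and their splitting at an apex *)

Section Dissections.
Variable n : nat.
Local Notation chord := ('I_n.+1 * 'I_n.+1)%type.
Implicit Types (l j r : nat) (T : {set chord}) (d e : chord).

Definition noncrossing T := [forall d in T, forall e in T, ~~ crossing d e].

(** Only the sides [{i, i+1}] are excluded; [{l, r}] itself is allowed whenever it is not one of
    them. *)
Definition long_chords l r : {set chord} :=
  [set d : chord | [&& (l <= d.1)%N, (d.1.+1 < d.2)%N & (d.2 <= r)%N]].

(* The side [{l, r}] as a set with one chord, or empty when [r = l + 1]. *)
Definition base l r : {set chord} :=
  [set d : chord | [&& d.1 == l :> nat, d.2 == r :> nat & (l.+1 < r)%N]].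

(* Triangulations together with the side [{l, r}]: counting this side makes them
   closed under restriction to both sides of the apex. *)
Definition dissections l r : {set {set chord}} :=
  [set T : {set chord} | [&& T \subset long_chords l r, noncrossing T & #|T| == (r - l).-1]].

Lemma noncrossingP T :
  reflect {in T &, forall d e, ~~ crossing d e} (noncrossing T).
Proof.
apply: (iffP forall_inP) => H.
  by move=> d e dT eT; exact: (forall_inP (H d dT) e eT).
by move=> d dT; apply/forall_inP => e eT; exact: H.
Qed.

Lemma noncrossingI T U : noncrossing T -> noncrossing (T :&: U).
Proof.
move/noncrossingP => H; apply/noncrossingP => d e /setIP[? _] /setIP[? _].
exact: H.
Qed.

Lemma card_base l r : (r <= n)%N -> #|base l r| = (l.+1 < r)%N.
Proof.
move=> rn; case: ltnP => lr; last first.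
  by apply/eqP; rewrite cards_eq0; apply/eqP/setP => d; rewrite !inE; lia.
have ln : (l < n.+1)%N by lia.
rewrite (_ : base l r = [set (Ordinal ln, Ordinal (rn : (r < n.+1)%N))]) ?cards1 //.
by apply/setP => -[a b]; rewrite !inE xpair_eqE -!val_eqE /=; lia.
Qed.

Lemma noncrossing_split l r T :
    (l.+1 < r)%N -> noncrossing T -> T \subset long_chords l r ->
  exists2 j, (l < j < r)%N &
    T = (T :&: base l r) :|: (T :&: long_chords l j) :|: (T :&: long_chords j r).
Proof.
move=> lr /noncrossingP ncT /subsetP Tlr.
(* The apex is the last vertex joined to [l], other than [r]. *)
pose P j := (l < j < r)%N &&
  ((j == l.+1) || [exists d in T, (d.1 == l :> nat) && (d.2 == j :> nat)]).
have exP : exists j, P j by exists l.+1; rewrite /P; lia.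
have ubP j : P j -> (j <= r)%N by rewrite /P; lia.
case: (ex_maxnP exP ubP) => j /andP[ljr edge_j] max_j; exists j => //.
apply/setP => -[a b]; rewrite !inE -!andb_orr /=; case dT: (_ \in T) => //=; symmetry.
have := Tlr _ dT; rewrite inE /= => /and3P[la ab br].
(* A chord from [l] is the base or, by maximality of [j], ends no later than [j]. *)
have [al|al] : (a = l :> nat) \/ (l < a)%N by lia.
  have [->|b_r] : (b = r :> nat) \/ (b < r)%N by lia.
    by rewrite al !eqxx lr.
  have /max_j : P b.
    rewrite /P; apply/andP; split; first by lia.
    by apply/orP; right; apply/existsP; exists (a, b); rewrite dT al !eqxx.
  lia.
(* A chord with [l < a < j < b] would cross [{l, j}]; if [j = l + 1], no such [a] exists. *)
case/orP: edge_j => [/eqP|/existsP[[a' b'] /and3P[eT /eqP /= el /eqP /= ej]]]; first by lia.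
have := ncT _ _ eT dT; rewrite /crossing /=; lia.
Qed.

(** Induction along the split: the base contributes at most 1 and the two parts at most [j - l - 1]
    and [r - j - 1], in total [r - l - 1]. *)
Lemma card_noncrossing l r T : (l < r)%N -> (r <= n)%N ->
  noncrossing T -> T \subset long_chords l r -> (#|T| <= (r - l).-1)%N.
Proof.
have [k] := ubnP (r - l); elim: k l r T => // k IH l r T rlk lr rn ncT Tlr.
have [lr1|lr1] := ltnP l.+1 r; last first.
  have -> : T = set0; last by rewrite cards0.
  by apply/setP => d; rewrite inE; apply/negP => /(subsetP Tlr); rewrite inE; lia.
have [j ljr ->] := noncrossing_split lr1 ncT Tlr.
have b1 : (#|T :&: long_chords l j| <= (j - l).-1)%N.
  by apply: IH; rewrite ?noncrossingI ?subsetIr //; lia.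
have b2 : (#|T :&: long_chords j r| <= (r - j).-1)%N.
  by apply: IH; rewrite ?noncrossingI ?subsetIr //; lia.
have b3 := subset_leq_card (subsetIr T (base l r)); rewrite card_base // lr1 in b3.
by rewrite !cardsU; lia.
Qed.

Lemma dissectionsP l r T :
  reflect [/\ T \subset long_chords l r, noncrossing T & #|T| = (r - l).-1]
          (T \in dissections l r).
Proof.
rewrite inE; apply: (iffP and3P) => -[? ? /eqP]; first by split.
by move=> ?; split.
Qed.

(** A dissection attains the bound of [card_noncrossing], so each of the three pieces attains its
    own: the base is present and both restrictions are again dissections. *)
Lemma dissection_split l r T : (l.+1 < r)%N -> (r <= n)%N ->
  T \in dissections l r ->
  [/\ base l r \subset T &
  exists2 j, (l < j < r)%N &
    [/\ T :&: long_chords l j \in dissections l j,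
        T :&: long_chords j r \in dissections j r &
        T = base l r :|: (T :&: long_chords l j) :|: (T :&: long_chords j r)]].
Proof.
move=> lr rn /dissectionsP[Tlr ncT cT].
have [j ljr eT] := noncrossing_split lr ncT Tlr.
have b1 : (#|T :&: long_chords l j| <= (j - l).-1)%N.
  by apply: card_noncrossing; rewrite ?subsetIr ?noncrossingI //; lia.
have b2 : (#|T :&: long_chords j r| <= (r - j).-1)%N.
  by apply: card_noncrossing; rewrite ?subsetIr ?noncrossingI //; lia.
have b3 := subset_leq_card (subsetIr T (base l r)).
have cb : #|base l r| = 1%N by rewrite card_base // lr.
have b4 := cT; rewrite {1}eT !cardsU in b4.
have eb : T :&: base l r = base l r.
  by apply/eqP; rewrite eqEcard subsetIr cb; lia.
split; first by rewrite -eb subsetIl.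
exists j => //; split.
- by apply/dissectionsP; split; rewrite ?subsetIr ?noncrossingI //; lia.
- by apply/dissectionsP; split; rewrite ?subsetIr ?noncrossingI //; lia.
- by rewrite {1}eT eb.
Qed.

Lemma base_sub_dissection l r T : (r <= n)%N ->
  T \in dissections l r -> base l r \subset T.
Proof.
move=> rn TD; have [lr|lr] := ltnP l.+1 r.
  by have [] := dissection_split lr rn TD.
by apply/subsetP => d; rewrite inE; lia.
Qed.

Lemma dissections_adjacent l : dissections l l.+1 = [set set0].
Proof.
apply/setP => T; rewrite inE [RHS]inE; apply/and3P/eqP => [[_ _]|->].
  by rewrite subSnn cards_eq0 => /eqP.
rewrite sub0set cards0 subSnn; split=> //.
by apply/noncrossingP => d e; rewrite inE.
Qed.

(** * Gluing two dissections, and uniqueness of the apex *)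

Definition glue l r (p : {set chord} * {set chord}) := base l r :|: p.1 :|: p.2.

(** Chords on opposite sides of [j] meet at most at [j], and the base encloses them all, so no
    crossing arises. No chord belongs to two pieces, hence the sizes add up and restriction recovers
    each part. *)
Lemma glue_dissection l j r T1 T2 : (l < j < r)%N -> (r <= n)%N ->
    T1 \in dissections l j -> T2 \in dissections j r ->
  [/\ glue l r (T1, T2) \in dissections l r,
      glue l r (T1, T2) :&: long_chords l j = T1 &
      glue l r (T1, T2) :&: long_chords j r = T2].
Proof.
move=> ljr rn /dissectionsP[/subsetP s1 /noncrossingP nc1 c1].
move=> /dissectionsP[/subsetP s2 /noncrossingP nc2 c2].
have d0 d : d \in base l r -> (d.1 = l :> nat) /\ (d.2 = r :> nat).
  by rewrite inE => /and3P[/eqP ? /eqP ? _].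
have d1 d : d \in T1 -> [&& (l <= d.1)%N, (d.1.+1 < d.2)%N & (d.2 <= j)%N].
  by move/s1; rewrite inE.
have d2 d : d \in T2 -> [&& (j <= d.1)%N, (d.1.+1 < d.2)%N & (d.2 <= r)%N].
  by move/s2; rewrite inE.
split.
- apply/dissectionsP; rewrite /glue /=; split.
  + apply/subsetP => d /setUP[/setUP[/d0[]|/d1]|/d2]; rewrite inE; lia.
  + apply/noncrossingP => d e /setUP[/setUP[/d0[] ? ?|dT]|dT] /setUP[/setUP[/d0[] ? ?|eT]|eT];
      try (by apply: nc1); try (by apply: nc2); rewrite /crossing;
      try (have := d1 _ dT); try (have := d1 _ eT); try (have := d2 _ dT);
      try (have := d2 _ eT); lia.
  + rewrite cardsU cardsU.
    have -> : base l r :&: T1 = set0.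
      by apply/setP => d; rewrite in_setI in_set0; apply/andP => -[/d0[? ?] /d1]; lia.
    have -> : (base l r :|: T1) :&: T2 = set0.
      apply/setP => d; rewrite in_setI in_set0; apply/andP.
      by case=> /setUP[/d0[? ?]|/d1 ?] /d2; lia.
    by rewrite !cards0 card_base // c1 c2; lia.
- apply/setP => d; rewrite in_setI; apply/andP/idP => [|dT].
    by case=> /setUP[/setUP[/d0[? ?]|//]|/d2 ?]; rewrite inE; lia.
  by rewrite /glue !in_setU dT orbT s1.
- apply/setP => d; rewrite in_setI; apply/andP/idP => [|dT].
    by case=> /setUP[/setUP[/d0[? ?]|/d1 ?]|//]; rewrite inE; lia.
  by rewrite /glue !in_setU dT orbT s2.
Qed.

Definition apex l r T j :=
  (T :&: long_chords l j \in dissections l j) &&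
  (T :&: long_chords j r \in dissections j r).

(** If [j < k], the bases [{l, k}] and [{j, r}] would both lie in [T] and cross. Used in both
    directions, this makes the apex unique. *)
Lemma apex_le l r T j k : (l < j < r)%N -> (l < k < r)%N -> (r <= n)%N ->
  noncrossing T -> apex l r T j -> apex l r T k -> (k <= j)%N.
Proof.
move=> ljr lkr rn /noncrossingP ncT /andP[_ jr] /andP[lk _].
rewrite leqNgt; apply/negP => jk.
have ln : (l < n.+1)%N by lia.
have jn : (j < n.+1)%N by lia.
have kn : (k < n.+1)%N by lia.
have rn1 : (r < n.+1)%N by lia.
have dT : (Ordinal ln, Ordinal kn) \in T.
  have /subsetP/(_ (Ordinal ln, Ordinal kn)) := base_sub_dissection (kn : (k <= n)%N) lk.
  by rewrite !inE /= => /(_ _)/andP[|//]; lia.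
have eT : (Ordinal jn, Ordinal rn1) \in T.
  have /subsetP/(_ (Ordinal jn, Ordinal rn1)) := base_sub_dissection rn jr.
  by rewrite !inE /= => /(_ _)/andP[|//]; lia.
have := ncT _ _ dT eT; rewrite /crossing /=; lia.
Qed.

Lemma sum_dissections (V : nmodType) l r (G : {set chord} -> V) :
    (l.+1 < r)%N -> (r <= n)%N ->
  \sum_(T in dissections l r) G T =
  \sum_(l.+1 <= j < r) \sum_(T1 in dissections l j) \sum_(T2 in dissections j r)
     G (glue l r (T1, T2)).
Proof.
move=> lr rn.
(* Each dissection has exactly one apex, so grouping by apex counts it once. *)
transitivity (\sum_(l.+1 <= j < r)
    \sum_(T in dissections l r | apex l r T j) G T).
  under [RHS]eq_bigr do rewrite big_mkcondr.
  rewrite exchange_big /=; apply: eq_bigr => T TD.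
  have [_ [j ljr [T1 T2 _]]] := dissection_split lr rn TD.
  have [_ ncT _] := dissectionsP _ _ _ TD.
  have apj : apex l r T j by rewrite /apex T1.
  rewrite (bigD1_seq j) ?iota_uniq ?mem_index_iota //= apj.
  rewrite big_nat_cond big1 ?addr0 // => k /andP[lkr kj].
  case: ifP => // apk.
  by have := apex_le ljr lkr rn ncT apj apk; have := apex_le lkr ljr rn ncT apk apj; lia.
apply: eq_big_nat => j ljr; rewrite pair_big /=.
(* For a fixed apex, gluing and restricting are mutually inverse. *)
rewrite (reindex_onto (glue l r) (fun T => (T :&: long_chords l j, T :&: long_chords j r))).
  apply: eq_big => // -[T1 T2] /=.
  apply/andP/andP => [[/andP[_ /andP[a1 a2]] /eqP[e1 e2]]|[T1D T2D]].
    by rewrite e1 in a1; rewrite e2 in a2.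
  by have [gD e1 e2] := glue_dissection ljr rn T1D T2D; rewrite gD /apex e1 e2 T1D T2D.
move=> T /andP[TD apj].
have [_ [k lkr [T1 T2 eT]]] := dissection_split lr rn TD.
have [_ ncT _] := dissectionsP _ _ _ TD.
have apk : apex l r T k by rewrite /apex T1.
suff -> : j = k by rewrite /glue /= -eT.
by have := apex_le ljr lkr rn ncT apj apk; have := apex_le lkr ljr rn ncT apk apj; lia.
Qed.

(** * Passing between triangulations and dissections *)

Lemma is_diagonalE l r d :
  is_diagonal l r d = (d \in long_chords l r :\: base l r).
Proof. by rewrite !inE /is_diagonal /is_side; lia. Qed.

Lemma triangulationsP l r T :
  reflect [/\ T \subset long_chords l r :\: base l r, noncrossing T &
              #|T| = (r - l - 2)%N]
          (T \in triangulations n l r).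
Proof.
rewrite inE /is_triangulation.
have -> : [forall d in T, is_diagonal l r d] = (T \subset long_chords l r :\: base l r).
  apply/forall_inP/subsetP => H d dT; first by rewrite -is_diagonalE H.
  by rewrite is_diagonalE H.
by apply: (iffP and3P) => -[? ? /eqP ?]; split=> //; apply/eqP.
Qed.

Lemma noncrossing_base l r T : T \subset long_chords l r ->
  noncrossing T -> noncrossing (T :|: base l r).
Proof.
move=> /subsetP TL /noncrossingP ncT; apply/noncrossingP => -[a b] [a' b'].
have long x y : (x, y) \in T -> [&& (l <= x)%N, (x.+1 < y)%N & (y <= r)%N].
  by move/TL; rewrite inE.
have short (x y : 'I_n.+1) : (x, y) \in base l r -> (x = l :> nat) /\ (y = r :> nat).
  by rewrite inE => /and3P[/eqP ? /eqP ? _].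
move=> /setUP[dT|/short[? ?]] /setUP[eT|/short[? ?]]; first exact: ncT.
- by have := long _ _ dT; rewrite /crossing /=; lia.
- by have := long _ _ eT; rewrite /crossing /=; lia.
- by rewrite /crossing /=; lia.
Qed.

(** Adding and removing the base are inverse bijections, because the base crosses no chord of the
    polygon and lies in every dissection. *)
Lemma sum_triangulations (V : nmodType) l r (G : {set chord} -> V) :
    (l < r)%N -> (r <= n)%N ->
  \sum_(T in triangulations n l r) G T =
  \sum_(T in dissections l r) G (T :\: base l r).
Proof.
move=> lr rn.
have sb : base l r \subset long_chords l r.
  by apply/subsetP => d; rewrite !inE; lia.
rewrite (reindex_onto (fun T => T :\: base l r) (fun T => T :|: base l r)).
  apply: eq_bigl => T; apply/andP/idP => [[/triangulationsP[TL ncT cT] /eqP e]|TD].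
    have bT : base l r \subset T by rewrite -e subsetUr.
    have TL' := subset_trans TL (subsetDl _ _).
    apply/dissectionsP; split; first by rewrite -e subUset TL'.
      by rewrite -e; apply: noncrossing_base.
    by have := cardsID (base l r) T; rewrite (setIidPr bT) cT card_base //; lia.
  have bT := base_sub_dissection rn TD.
  have /dissectionsP[TL ncT cT] := TD; split; last first.
    by rewrite setUC -{1}(setIidPr bT) setID.
  apply/triangulationsP; split; [exact: setSD|by rewrite setDE noncrossingI|].
  by have := cardsID (base l r) T; rewrite (setIidPr bT) cT card_base //; lia.
move=> T /triangulationsP[TL _ _].
rewrite setDUl setDv setU0; apply/setDidPl.
by move: TL; rewrite subsetD => /andP[].
Qed.

(** * Triangles of a dissection and of its two parts *)

Definition edge l r T d :=
  [&& (l <= d.1)%N, (d.1 < d.2)%N, (d.2 <= r)%N & (d.2 == d.1.+1 :> nat) || (d \in T)].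

Definition dtriangles l r T : {set 'I_n.+1 * 'I_n.+1 * 'I_n.+1} :=
  [set t | [&& edge l r T (t.1.1, t.1.2), edge l r T (t.1.2, t.2) &
               edge l r T (t.1.1, t.2)]].

(** The side [{l, r}] needs no clause of its own in [edge]: it is a chord of [T], or a short side
    when [r = l + 1]. *)
Lemma is_edgeE l r T d : (l < r)%N -> (r <= n)%N -> T \in dissections l r ->
  is_edge l r (T :\: base l r) d = edge l r T d.
Proof.
move=> lr rn TD; have /subsetP/(_ d) := base_sub_dissection rn TD.
have [/subsetP/(_ d)] := dissectionsP _ _ _ TD.
rewrite /is_edge /is_side /edge !inE; case: (d \in T) => /=; lia.
Qed.

Lemma trianglesE l r T : (l < r)%N -> (r <= n)%N -> T \in dissections l r ->
  triangles l r (T :\: base l r) = dtriangles l r T.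
Proof.
by move=> lr rn TD; apply/setP => -[[a b] c]; rewrite !inE /= !is_edgeE.
Qed.

Lemma edge_glue l j r T1 T2 d : (l < j < r)%N ->
    T1 \in dissections l j -> T2 \in dissections j r ->
  edge l r (glue l r (T1, T2)) d =
  [|| (d.1 == l :> nat) && (d.2 == r :> nat), edge l j T1 d | edge j r T2 d].
Proof.
move=> ljr /dissectionsP[/subsetP/(_ d) s1 _ _] /dissectionsP[/subsetP/(_ d) s2 _ _].
move: s1 s2; rewrite /edge /glue !inE /=.
by case: (d \in T1); case: (d \in T2) => /=; lia.
Qed.

Lemma edge_bounds l r T (a b : 'I_n.+1) :
  edge l r T (a, b) -> [&& (l <= a)%N, (a < b)%N & (b <= r)%N].
Proof. by case/and4P=> /= -> -> ->. Qed.

Lemma edge_base T (a b : 'I_n.+1) : (a < b)%N -> (b <= n)%N ->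
  T \in dissections a b -> edge a b T (a, b).
Proof.
move=> ab bn TD; rewrite /edge /= !leqnn ab /=.
have [->|ab1] : (b = a.+1 :> nat) \/ (a.+1 < b)%N by lia.
  by rewrite eqxx.
apply/orP; right; apply: (subsetP (base_sub_dissection bn TD)).
by rewrite inE /= !eqxx ab1.
Qed.

(** The only triangle not inside one of the two parts is the one on the base with apex [j]. *)
Lemma sum_dtriangles_glue (V : nmodType) (f : nat -> nat -> nat -> V) l j r T1 T2 :
    (l < j < r)%N -> (r <= n)%N ->
    T1 \in dissections l j -> T2 \in dissections j r ->
  \sum_(t in dtriangles l r (glue l r (T1, T2))) f t.1.1 t.1.2 t.2 =
  f l j r + \sum_(t in dtriangles l j T1) f t.1.1 t.1.2 t.2
          + \sum_(t in dtriangles j r T2) f t.1.1 t.1.2 t.2.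
Proof.
move=> ljr rn D1 D2.
have ln : (l < n.+1)%N by lia.
have jn : (j < n.+1)%N by lia.
have rn1 : (r < n.+1)%N by lia.
pose t0 := (Ordinal ln, Ordinal jn, Ordinal rn1).
have edge_lj : edge l j T1 (Ordinal ln, Ordinal jn).
  by apply: edge_base => /=; [lia | lia | exact: D1].
have edge_jr : edge j r T2 (Ordinal jn, Ordinal rn1).
  by apply: edge_base => /=; [lia | exact: rn | exact: D2].
have -> : dtriangles l r (glue l r (T1, T2)) =
    t0 |: (dtriangles l j T1 :|: dtriangles j r T2).
  apply/setP => -[[a b] c]; rewrite !inE /= !(edge_glue _ ljr D1 D2).
  apply/idP/idP => [/and3P[ab bc]|/or3P[/eqP[-> -> ->]|/and3P[-> -> ->]|/and3P[-> -> ->]]];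
    last 3 first.
  - by rewrite edge_lj edge_jr /= !eqxx !orbT.
  - by rewrite !orbT.
  - by rewrite !orbT.
  have [lta ltb] : (a < b)%N /\ (b < c)%N.
    split; [move: ab|move: bc].
      by case/or3P=> [/andP[/eqP /= ? /eqP /= ?]|/edge_bounds|/edge_bounds]; lia.
    by case/or3P=> [/andP[/eqP /= ? /eqP /= ?]|/edge_bounds|/edge_bounds]; lia.
  (* The longest edge decides: if it is the base, the other two edges squeeze [b] to [j]; if it lies
     in one part, they lie there too. *)
  case/or3P=> [/andP[/eqP /= al /eqP /= cr]|ac|ac].
  - suff bj : b = j :> nat by rewrite /t0 !xpair_eqE -!val_eqE /= al bj cr !eqxx.
    have bj : (b <= j)%N.
      by case/or3P: ab => [/andP[_ /eqP /= ?]|/edge_bounds|/edge_bounds]; lia.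
    have jb : (j <= b)%N.
      by case/or3P: bc => [/andP[/eqP /= ? _]|/edge_bounds|/edge_bounds]; lia.
    by lia.
  - have acj := edge_bounds ac; rewrite ac andbT.
    have -> : edge l j T1 (a, b).
      by case/or3P: ab => [/andP[_ /eqP /= ?]|//|/edge_bounds]; lia.
    have -> : edge l j T1 (b, c).
      by case/or3P: bc => [/andP[_ /eqP /= ?]|//|/edge_bounds]; lia.
    by rewrite orbT.
  - have acj := edge_bounds ac; rewrite ac andbT.
    have -> : edge j r T2 (a, b).
      by case/or3P: ab => [/andP[/eqP /= ? _]|/edge_bounds|//]; lia.
    have -> : edge j r T2 (b, c).
      by case/or3P: bc => [/andP[/eqP /= ? _]|/edge_bounds|//]; lia.
    by rewrite !orbT.
rewrite big_setU1; last first.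
  rewrite !inE /=; apply/negP.
  by case/orP=> /and3P[_ _ /edge_bounds /=]; lia.
rewrite -addrA; congr (_ + _).
rewrite -bigU //=.
  by apply: eq_bigl => t; rewrite !inE.
(* A common triangle would have [c <= j <= a], against [a < c]. *)
rewrite -setI_eq0; apply/eqP/setP => -[[a b] c]; rewrite !inE /=.
apply/negbTE/negP => /andP[/and3P[_ _ /edge_bounds ac] /and3P[_ _ /edge_bounds]].
by lia.
Qed.
End Dissections.

(** * Moments of the weight sum *)

Section Moments.
Variables (F : numFieldType) (n : nat) (f : nat -> nat -> nat -> F).
Hypothesis hf : translation_invariant n f.
Local Notation c := (@catalan F).
Local Notation D := (dissections n).

(** Splitting at the apex gives Segner's recurrence for the count. *)
Lemma card_dissections l r : (l < r)%N -> (r <= n)%N ->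
  #|D l r|%:R = c (r - l - 1).
Proof.
have [k] := ubnP (r - l); elim: k l r => // k IH l r rlk lr rn.
have [lr1|rl1] := ltnP l.+1 r; last first.
  have -> : r = l.+1 by lia.
  by rewrite dissections_adjacent cards1 subSnn catalan0.
rewrite -sum1_card natr_sum sum_dissections //.
transitivity (\sum_(l.+1 <= j < r) c (j - l.+1) * c (r - l.+2 - (j - l.+1))).
  apply: eq_big_nat => j ljr.
  rewrite !sumr_const mulr1n -mulr_natr !IH; try lia.
  by rewrite mulrC; congr (c _ * c _); lia.
rewrite -{1}[l.+1]add0n big_addn.
have -> : (r - l.+1 = (r - l.+2).+1)%N by lia.
rewrite big_mkord.
have -> : (r - l - 1 = (r - l.+2).+1)%N by lia.
by rewrite -catalan_conv; apply: eq_bigr => i _; rewrite addnK.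
Qed.

Definition weight l r T := \sum_(t in @dtriangles n l r T) f t.1.1 t.1.2 t.2.

Definition moment m l r := \sum_(T in D l r) weight l r T ^+ m.

Lemma expect_weight_sum m l r : (l < r)%N -> (r <= n)%N ->
  expect l r (fun T => @weight_sum n F f l r T ^+ m) = moment m l r / c (r - l - 1).
Proof.
move=> lr rn; rewrite /expect.
have -> : #|triangulations n l r|%:R = c (r - l - 1).
  rewrite -sum1_card natr_sum sum_triangulations // -natr_sum sum1_card.
  exact: card_dissections.
rewrite -mulr_suml sum_triangulations //; congr (_ / _); apply: eq_bigr => T TD.
by rewrite /weight_sum trianglesE.
Qed.

Lemma moment0 l r : (l < r)%N -> (r <= n)%N -> moment 0 l r = c (r - l - 1).
Proof. by move=> *; rewrite -card_dissections // -sum1_card natr_sum. Qed.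

Lemma moment_rec m l r : (l.+1 < r)%N -> (r <= n)%N ->
  moment m l r = \sum_(l.+1 <= j < r) \sum_(T1 in D l j) \sum_(T2 in D j r)
    (f l j r + weight l j T1 + weight j r T2) ^+ m.
Proof.
move=> lr rn; rewrite /moment sum_dissections //.
apply: eq_big_nat => j ljr; apply: eq_bigr => T1 D1; apply: eq_bigr => T2 D2.
by rewrite /weight (sum_dtriangles_glue _ ljr).
Qed.

(** The two parts vary independently, so the double sum factors. *)
Lemma sum_moment_mul a k m l j r :
  \sum_(T1 in D l j) \sum_(T2 in D j r) a * (weight l j T1 ^+ k * weight j r T2 ^+ m) =
  a * (moment k l j * moment m j r).
Proof.
by rewrite big_distrlr mulr_sumr; apply: eq_bigr => T1 _; rewrite mulr_sumr.
Qed.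

(** The exponent is positive because the zeroth moment counts the empty dissection. *)
Lemma moment_adjacent m l : (l < n)%N -> moment m.+1 l l.+1 = 0.
Proof.
move=> ln; rewrite /moment dissections_adjacent big_set1 /weight.
rewrite big_pred0 ?expr0n // => -[[a b] d]; rewrite inE /edge /=; lia.
Qed.

Lemma moment1_rec l r : (l < r)%N -> (r <= n)%N ->
  moment 1 l r = \sum_(l.+1 <= j < r)
    (f l j r * c (j - l - 1) * c (r - j - 1) +
     moment 1 l j * c (r - j - 1) + c (j - l - 1) * moment 1 j r).
Proof.
move=> lr rn; have [lr1|rl1] := ltnP l.+1 r; last first.
  by rewrite big_geq // (_ : r = l.+1) ?moment_adjacent //; lia.
rewrite moment_rec //; apply: eq_big_nat => j ljr.
(* Zeroth powers and unit factors are kept so that every term has the shape of [sum_moment_mul]. *)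
transitivity (\sum_(T1 in D l j) \sum_(T2 in D j r)
   (f l j r * (weight l j T1 ^+ 0 * weight j r T2 ^+ 0) +
    1 * (weight l j T1 ^+ 1 * weight j r T2 ^+ 0) +
    1 * (weight l j T1 ^+ 0 * weight j r T2 ^+ 1))).
  by apply: eq_bigr => T1 _; apply: eq_bigr => T2 _; ring.
under eq_bigr do rewrite !big_split.
rewrite !big_split !sum_moment_mul /= !moment0; try lia.
by ring.
Qed.

(** Expanding the square leaves second moments only in the last two terms; the rest involves [f] and
    first moments and serves as the source term [g]. *)
Lemma moment2_rec l r : (l < r)%N -> (r <= n)%N ->
  moment 2 l r = \sum_(l.+1 <= j < r)
    (f l j r ^+ 2 * c (j - l - 1) * c (r - j - 1)
      + 2 * f l j r * (moment 1 l j * c (r - j - 1) + c (j - l - 1) * moment 1 j r)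
      + 2 * moment 1 l j * moment 1 j r
     + moment 2 l j * c (r - j - 1) + c (j - l - 1) * moment 2 j r).
Proof.
move=> lr rn; have [lr1|rl1] := ltnP l.+1 r; last first.
  by rewrite big_geq // (_ : r = l.+1) ?moment_adjacent //; lia.
rewrite moment_rec //; apply: eq_big_nat => j ljr.
transitivity (\sum_(T1 in D l j) \sum_(T2 in D j r)
   (f l j r ^+ 2 * (weight l j T1 ^+ 0 * weight j r T2 ^+ 0) +
    2 * f l j r * (weight l j T1 ^+ 1 * weight j r T2 ^+ 0) +
    2 * f l j r * (weight l j T1 ^+ 0 * weight j r T2 ^+ 1) +
    2 * (weight l j T1 ^+ 1 * weight j r T2 ^+ 1) +
    1 * (weight l j T1 ^+ 2 * weight j r T2 ^+ 0) +
    1 * (weight l j T1 ^+ 0 * weight j r T2 ^+ 2))).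
  by apply: eq_bigr => T1 _; apply: eq_bigr => T2 _; ring.
under eq_bigr do rewrite !big_split.
rewrite !big_split !sum_moment_mul /= !moment0; try lia.
ring.
Qed.

Lemma f_shift l j r d : (1 <= l)%N -> (l < j < r)%N -> (r + d <= n)%N ->
  f (l + d)%N (j + d)%N (r + d)%N = f l j r.
Proof. by move=> l1 ljr rdn; apply: hf; lia. Qed.

Lemma moment1_shift l r d : (1 <= l)%N -> (l < r)%N -> (r + d <= n)%N ->
  moment 1 (l + d) (r + d) = moment 1 l r.
Proof.
apply: recurrence_shift moment1_rec _ _ _ => l' j r' d' l1 ljr rdn.
by rewrite f_shift //; congr (_ * c _ * c _); lia.
Qed.

(** Shifting by [n - r] moves the last vertex to [n], where [mean] is defined. *)
Lemma moment1_mean l r : (1 <= l)%N -> (l < r)%N -> (r <= n)%N ->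
  moment 1 l r = mean n f (l + n - r) * c (r - l - 1).
Proof.
move=> l1 lr rn; have -> : moment 1 l r = moment 1 (l + n - r) n.
  rewrite -(@moment1_shift l r (n - r)) //; last by lia.
  by congr (moment 1 _ _); lia.
have := @expect_weight_sum 1 (l + n - r) n; rewrite /mean /expect => H.
under eq_bigr do rewrite -[weight_sum _ _ _ _]expr1.
rewrite H; try lia.
have -> : (n - (l + n - r) - 1 = r - l - 1)%N by lia.
by rewrite divfK // catalan_neq0.
Qed.

Lemma moment1_formula l : (1 <= l)%N -> (l <= n - 1)%N ->
  moment 1 l n = \sum_(l <= j < n - 1) beta n f j * 'C(2 * j - 2 * l, j - l)%:R.
Proof.
apply: recurrence_solution moment1_rec _ => l' j r' d' l1 ljr rdn.
by rewrite f_shift //; congr (_ * c _ * c _); lia.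
Qed.

Lemma moment2_formula l : (1 <= l)%N -> (l <= n - 1)%N ->
  moment 2 l n = \sum_(l <= j < n - 1) lambda n f j * 'C(2 * j - 2 * l, j - l)%:R.
Proof.
move=> l1 ln; rewrite (recurrence_solution _ moment2_rec) //.
  apply: eq_big_nat => s lsn; congr (_ * _); rewrite /lambda.
  (* Each first moment is a mean times a Catalan number; factoring these out of the source term
     leaves the summand of [lambda]. *)
  apply: eq_big_nat => j sjn; rewrite !moment1_mean; try lia.
  rewrite addnK; ring.
move=> l' j r' d' l'1 ljr rdn; rewrite f_shift // !moment1_shift; try lia.
by congr (_ * c _ * c _ + _ * (_ * c _ + c _ * _) + _); lia.
Qed.

End Moments.

Theorem theorem1 (R : realType) (n : nat) (f : nat -> nat -> nat -> R[i])
    (hn : (2 <= n)%N) (hf : translation_invariant n f) :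
  [/\ forall l : nat, (1 <= l)%N -> (l <= n - 1)%N ->
        expect l n (@weight_sum n R[i] f l n) =
        1 / catalan (n - l - 1) *
          \sum_(l <= j < n - 1) beta n f j * 'C(2 * j - 2 * l, j - l)%:R,
      expect 1 n (@weight_sum n R[i] f 1 n) =
        1 / catalan (n - 2) *
          \sum_(1 <= j < n - 1) beta n f j * 'C(2 * j - 2, j - 1)%:R
    & variance 1 n (@weight_sum n R[i] f 1 n) =
        1 / catalan (n - 2) *
          (\sum_(1 <= j < n - 1) lambda n f j * 'C(2 * j - 2, j - 1)%:R)
        - 1 / catalan (n - 2) ^+ 2 *
          (\sum_(1 <= j < n - 1) beta n f j * 'C(2 * j - 2, j - 1)%:R) ^+ 2].
Proof.
have mean_formula l : (1 <= l)%N -> (l <= n - 1)%N ->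
    expect l n (@weight_sum n R[i] f l n) =
    1 / catalan (n - l - 1) *
      \sum_(l <= j < n - 1) beta n f j * 'C(2 * j - 2 * l, j - l)%:R.
  move=> l1 ln; rewrite -(moment1_formula hf) // div1r mulrC.
  by rewrite -expect_weight_sum //; lia.
have e1 : (1 <= n - 1)%N by lia.
(* Merges [n - 1 - 1] into [n - 2], the index in the statement. *)
have mean1 := mean_formula 1 isT e1; rewrite -subnDA in mean1.
split=> //; rewrite /variance mean1 expect_weight_sum; try lia.
rewrite (moment2_formula hf) // -subnDA exprMn expr_div_n expr1n.
by rewrite div1r [X in X - _]mulrC.
Qed.
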